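(* Let $F=(F_1,\dots,F_m):[B(\mathcal H)^n]_1\to[B(\mathcal H)^m]_1$ be a free holomorphic function. Then (i) the map $\varphi(X_1,\dots,X_n):=[X_1,\dots,X_n]F'(0)^t$, i.e. $\varphi(X)=\left(\sum_ia^{(1)}_{g_i}X_i,\dots,\sum_ia^{(m)}_{g_i}X_i\right)$, maps $[B(\mathcal H)^n]_1$ into $[B(\mathcal H)^m]_1$; in particular $\|F'(0)\|\le1$. (ii) If $F(0)=0$, then $\|F(X)\|\le\|X\|$ for all $X\in[B(\mathcal H)^n]_1$. *)

(* Defs.v *)
From HB Require Import structures.
From mathcomp Require Import all_boot all_order all_algebra.
From mathcomp Require Import complex.
From mathcomp Require Import all_classical all_reals all_analysis.
Set Implicit Arguments. Unset Strict Implicit. Unset Printing Implicit Defensive.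
Import Order.TTheory GRing.Theory Num.Theory ComplexField.
Local Open Scope ring_scope.
Local Open Scope classical_set_scope.

Definition cabs (R : realType) (z : R[i]) : R := complex.Re `|z|.

Definition is_inner_product (R : realType) (V : lmodType R[i]) (ip : V -> V -> R[i]) :=
  [/\ (forall (a : R[i]) (u v w : V), ip (a *: u + v) w = a * ip u w + ip v w),
      (forall u v : V, ip u v = conjc (ip v u)),
      (forall v : V, 0 <= ip v v) &
      (forall v : V, ip v v = 0 -> v = 0)].

Definition hnorm (R : realType) (V : lmodType R[i]) (ip : V -> V -> R[i]) (v : V) : R :=
  Num.sqrt (complex.Re (ip v v)).

Definition hilbert_complete (R : realType) (V : lmodType R[i]) (ip : V -> V -> R[i]) :=
  forall u : nat -> V,
    (forall e : R, 0 < e -> exists N, forall k l, (N <= k)%N -> (N <= l)%N ->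
        hnorm ip (u k - u l) < e) ->
    exists v : V, forall e : R, 0 < e -> exists N, forall k, (N <= k)%N ->
        hnorm ip (u k - v) < e.

Definition bounded_op (R : realType) (V : lmodType R[i]) (ip : V -> V -> R[i]) (T : V -> V) :=
  (forall (a : R[i]) (u v : V), T (a *: u + v) = a *: T u + T v) /\
  exists M : R, forall v, hnorm ip (T v) <= M * hnorm ip v.

Definition opnorm (R : realType) (V : lmodType R[i]) (ip : V -> V -> R[i]) (T : V -> V) : R :=
  sup [set r | exists h : V, hnorm ip h <= 1 /\ r = hnorm ip (T h)].

(* norm of the row operator [X_1, ..., X_n] : H^(n) -> H, i.e. of a tuple in B(H)^n;
   [B(H)^n]_1 is the set of tuples with rownorm < 1 *)
Definition rownorm (R : realType) (V : lmodType R[i]) (ip : V -> V -> R[i]) (n : nat)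
  (X : 'I_n -> V -> V) : R :=
  sup [set r | exists h : 'I_n -> V,
         \sum_(i < n) hnorm ip (h i) ^+ 2 <= 1 /\ r = hnorm ip (\sum_(i < n) X i (h i))].

Definition Xword (R : realType) (V : lmodType R[i]) (n : nat) (X : 'I_n -> V -> V)
  (w : seq 'I_n) : V -> V := foldr (fun i f => X i \o f) id w.

Definition fh_partial (R : realType) (V : lmodType R[i]) (n : nat) (a : seq 'I_n -> R[i])
  (X : 'I_n -> V -> V) (N : nat) : V -> V :=
  fun h => \sum_(k < N) \sum_(w : k.-tuple 'I_n) a w *: Xword X w h.

Definition free_holo_coeffs (R : realType) (n : nat) (a : seq 'I_n -> R[i]) :=
  (limn_esup (fun k : nat =>
     (powR (\sum_(w : k.-tuple 'I_n) cabs (a w) ^+ 2) (k.*2%:R^-1))%:E)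
   <= 1%:E)%E.

Definition fh_value (R : realType) (V : lmodType R[i]) (ip : V -> V -> R[i]) (n : nat)
  (a : seq 'I_n -> R[i]) (X : 'I_n -> V -> V) (T : V -> V) :=
  bounded_op ip T /\
  forall e : R, 0 < e -> exists N, forall N', (N <= N')%N ->
    opnorm ip (fun h => fh_partial a X N' h - T h) < e.

Definition mxnorm (R : realType) (m n : nat) (A : 'M[R[i]]_(m, n)) : R :=
  sup [set r | exists x : 'I_n -> R[i],
         \sum_(i < n) cabs (x i) ^+ 2 <= 1 /\
         r = Num.sqrt (\sum_(j < m) cabs (\sum_(i < n) A j i * x i) ^+ 2)].

(* Main.v *)
Require Import Defs.
From HB Require Import structures.
From mathcomp Require Import all_boot all_order all_algebra.
From mathcomp Require Import complex.
From mathcomp Require Import all_classical all_reals all_analysis.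
From mathcomp Require Import ring lra.
Import Order.TTheory GRing.Theory Num.Theory ComplexField.
Local Open Scope ring_scope.
Set Implicit Arguments. Unset Strict Implicit. Unset Printing Implicit Defensive.

(* For a row (h_j) in the unit ball of H^m, z |-> sum_j F_j(zX) h_j is a power series
   in z with vector coefficients C_k = sum_j sum_(|w| = k) a_w^(j) X_w h_j, bounded
   by 1 in norm as long as |z| ||X|| < 1.  Since ||sum_(|w| = k) a_w X_w|| is at most
   (sum_(|w| = k) |a_w|^2)^(1/2) ||X||^k, the partial sums converge uniformly on
   circles, so they are vector polynomials bounded by 1 + e there.  Pairing them with
   a fixed vector reduces (i) to the Cauchy estimate for C_1 and (ii) to the maximum
   principle for scalar polynomials.  The Cauchy estimate is an average over roots of
   unity, and the maximum principle follows from it applied to high powers.  The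
   bound on the matrix norm is (i) at tuples of scalar operators. *)

(** * The modulus as a real number *)

Lemma normr_cabs (R : realType) (z : R[i]) : `|z| = (cabs z)%:C%C.
Proof. by []. Qed.

Lemma cabs_ge0 (R : realType) (z : R[i]) : 0 <= cabs z.
Proof. by rewrite -lecR -normr_cabs normr_ge0. Qed.

Lemma cabsM (R : realType) (y z : R[i]) : cabs (y * z) = cabs y * cabs z.
Proof. by apply: (@complexI R); rewrite rmorphM /= -!normr_cabs normrM. Qed.

Lemma cabs_eq1 (R : realType) (z : R[i]) : `|z| = 1 -> cabs z = 1.
Proof. by rewrite /cabs => ->. Qed.

Lemma cabs_real (R : realType) (x : R) : 0 <= x -> cabs x%:C%C = x.
Proof. by move=> x0; rewrite /cabs ger0_norm // lecR. Qed.

(** * Roots of unity and scalar polynomials on the unit circle *)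

Lemma prim_root_pow2 (C : numClosedFieldType) (s : nat) :
  {z : C | (2 ^ s.+1)%N.-primitive_root z}.
Proof.
exists ((2 ^ s)%N.-root (-1)); set z := _.-root _.
have zs : z ^+ (2 ^ s) = -1 by rewrite rootCK // expn_gt0.
have zS : z ^+ (2 ^ s.+1) = 1 by rewrite expnSr exprM zs sqrrN expr1n.
have [|q zq] := @prim_order_exists _ _ z _ zS; first by rewrite expn_gt0.
(* The order of z is 2^j; if j <= s then z^(2^s) = 1, against the value -1. *)
case/dvdn_pfactor => // j; rewrite leq_eqVlt => /orP[/eqP <- <- //|].
rewrite ltnS => js qE; have : z ^+ (2 ^ s) == 1.
  by rewrite -(prim_order_dvd zq) qE dvdn_exp2l.
by rewrite zs -subr_eq0 -opprD oppr_eq0 (_ : 1 + 1 = 2%:R) // pnatr_eq0.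
Qed.

Lemma prim_root_sum_expr (C : fieldType) (L k : nat) (z : C) :
  L.-primitive_root z ->
  \sum_(l < L) (z ^+ k) ^+ l = if (L %| k)%N then L%:R else 0.
Proof.
move=> zL; rewrite (prim_order_dvd zL); have [->|nz] := eqVneq (z ^+ k) 1.
  by under eq_bigr do rewrite expr1n; rewrite sumr_const card_ord.
have : (z ^+ k - 1) * \sum_(l < L) (z ^+ k) ^+ l = 0.
  by rewrite -subrX1 -exprM mulnC exprM (prim_expr_order zL) expr1n subrr.
by move/eqP; rewrite mulf_eq0 subr_eq0 (negPf nz) => /eqP.
Qed.

(** Averaging p(w) w^(-i) over the L-th roots of unity w isolates the coefficient of index i once L
    exceeds the degree, and each term has modulus at most M. *)
Lemma coef_le_circle (C : numClosedFieldType) (p : {poly C}) (M : C) (i : nat) :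
  (forall z, `|z| = 1 -> `|p.[z]| <= M) -> `|p`_i| <= M.
Proof.
move=> pM; have M0 : 0 <= M by apply: le_trans (pM 1 (normr1 _)).
have [/(nth_default 0) -> |ip] := leqP (size p) i; first by rewrite normr0.
set L := (2 ^ (size p).+1)%N.
have [z zL] := prim_root_pow2 C (size p).
have pL : (size p < L)%N by apply: ltn_trans (ltnSn _) (ltn_expl _ _).
have iL := ltn_trans ip pL; have L0 : (0 < L)%N by exact: leq_ltn_trans pL.
have z1 : `|z| = 1.
  apply/eqP; rewrite -(@pexpr_eq1 _ _ L) // -normrX.
  by rewrite (prim_expr_order zL) normr1.
(* The exponent [L - i] stands for -i, since z^L = 1. *)
have avg : \sum_(l < L) p.[z ^+ l] * (z ^+ l) ^+ (L - i) = L%:R * p`_i.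
  under eq_bigr => l _ do rewrite horner_coef big_distrl /=.
  rewrite exchange_big /= (bigD1 (Ordinal ip)) //= [X in _ + X]big1 => [|k ki].
    rewrite addr0.
    under eq_bigr => l _ do
      rewrite -mulrA -exprD subnKC ?(ltnW iL) // exprAC.
    by rewrite -mulr_sumr (prim_root_sum_expr _ zL) dvdnn mulrC.
  under eq_bigr => l _ do rewrite -mulrA -exprD exprAC.
  rewrite -mulr_sumr (prim_root_sum_expr _ zL) ifF ?mulr0 //.
  (* A surviving index k would be congruent to i modulo L, hence equal to i as both are below L. *)
  apply: contraNF ki; rewrite addnBA ?(ltnW iL) // => LD.
  have : (k == i %[mod L])%N.
    have [ik|ki] := leqP i k.
      rewrite eqn_mod_dvd //; move: LD.
      by rewrite -addnBAC // dvdn_addl.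
    move: LD => /dvdnP[[|t]]; rewrite ?mul0n ?mulSn => /eqP.
      by rewrite subn_eq0 leqNgt ltn_addl.
    rewrite -(eqn_add2r i) subnK; last by rewrite ltnW // ltn_addl.
    rewrite addnC -addnA eqn_add2l => /eqP kE; move: ki.
    by rewrite kE ltnNge leq_addl.
  by rewrite !modn_small ?(ltn_trans (ltn_ord k)).
rewrite -(ler_pM2l (_ : 0 < L%:R)) ?ltr0n // -[X in X * `|_|]normr_nat -normrM.
rewrite -avg; apply: le_trans (ler_norm_sum _ _ _) _.
apply: (@le_trans _ _ (\sum_(l < L) M)); last first.
  by rewrite sumr_const card_ord mulr_natl.
apply: ler_sum => l _; rewrite normrM !normrX z1 !expr1n mulr1.
by apply: pM; rewrite normrX z1 expr1n.
Qed.

(** If u > v > 0, then (u / v)^N grows exponentially and cannot stay below d N + 1. *)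
Lemma le_of_expr_le_linear (R : archiRealFieldType) (u v : R) (d : nat) :
  0 <= v -> (forall N, u ^+ N <= (d * N).+1%:R * v ^+ N) -> u <= v.
Proof.
move=> v0 uv; rewrite leNgt; apply/negP => vu.
have [v_eq0|vn0] := eqVneq v 0.
  by have := uv 1%N; rewrite !expr1 v_eq0 mulr0 leNgt -v_eq0 vu.
have vp : 0 < v by rewrite lt_def vn0.
pose e := u / v - 1.
have ep : 0 < e by rewrite subr_gt0 ltr_pdivlMr // mul1r.
have tN N : (1 + e) ^+ N <= (d * N).+1%:R.
  by rewrite addrC subrK expr_div_n ler_pdivrMr ?exprn_gt0.
have bern N : N%:R * e <= (1 + e) ^+ N.
  elim: N => [|N IH]; first by rewrite mul0r expr0.
  rewrite exprS -natr1 mulrDl mul1r [X in _ <= X]mulrDl mul1r lerD //.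
  by rewrite ler_peMr ?(ltW ep) // exprn_ege1 // lerDl ltW.
(* Squaring Bernoulli's inequality gives N^2 e^2 <= (1 + e)^(2N) <= 2dN + 1 <= N (2d + 1), which
   bounds N by a constant. *)
have bound N : (0 < N)%N -> N%:R * e ^+ 2 <= (2 * d).+1%:R.
  move=> N0; have NR : 0 < N%:R :> R by rewrite ltr0n.
  rewrite -(ler_pM2l NR).
  apply: (@le_trans _ _ ((1 + e) ^+ (N * 2))).
    rewrite mulrA -expr2 -exprMn exprM; apply: lerXn2r; rewrite ?nnegrE //.
    - by rewrite mulr_ge0 ?ler0n // ltW.
    - by rewrite exprn_ge0 // addr_ge0 // ltW.
  apply: le_trans (tN _) _; rewrite -natrM ler_nat.
  by rewrite mulnCA [(d * 2)%N]mulnC [X in (_ <= X)%N]mulnS -add1n leq_add.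
pose N := (Num.trunc ((2 * d).+1%:R / e ^+ 2)).+1.
have := bound N isT; rewrite leNgt => /negP; apply.
rewrite -ltr_pdivrMr ?exprn_gt0 //; apply: truncnS_gt.
Qed.

(* Apply the coefficient estimate to p ^+ N, whose number of coefficients grows
   only linearly in N, and let N tend to infinity. *)
Lemma horner_le_circle (R : realType) (p : {poly R[i]}) (M : R) (x : R[i]) :
  (forall z : R[i], `|z| = 1 -> `|p.[z]| <= M%:C%C) -> `|x| <= 1 ->
  `|p.[x]| <= M%:C%C.
Proof.
move=> pM x1; have M0 : 0 <= M.
  by rewrite -lecR; exact: le_trans (normr_ge0 _) (pM 1 (normr1 _)).
rewrite normr_cabs lecR.
apply: (@le_of_expr_le_linear R _ M (size p).-1) => // N.
rewrite -lecR rmorphXn /= -normr_cabs rmorphM rmorphXn /= rmorph_nat -normrX -horner_exp.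
rewrite horner_coef; apply: le_trans (ler_norm_sum _ _ _) _.
apply: (@le_trans _ _ (\sum_(k < size (p ^+ N)) M%:C%C ^+ N)).
  apply: ler_sum => k _; rewrite normrM normrX.
  rewrite -[X in _ <= X]mulr1; apply: ler_pM => //; last exact: exprn_ile1.
  apply: coef_le_circle => z z1; rewrite horner_exp normrX.
  by apply: lerXn2r; rewrite ?nnegrE ?pM // lecR.
rewrite sumr_const card_ord -[X in X <= _]mulr_natl; apply: ler_wpM2r.
  by rewrite exprn_ge0 // lecR.
by rewrite ler_nat size_poly_exp_leq.
Qed.

(** * Inner product spaces *)

Section InnerProduct.
Variables (R : realType) (V : lmodType R[i]) (ip : V -> V -> R[i]).
Hypothesis ipP : is_inner_product ip.
Local Notation nm := (hnorm ip).

Lemma ip_linearl (c : R[i]) (u v w : V) : ip (c *: u + v) w = c * ip u w + ip v w.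
Proof. by case: ipP. Qed.

Lemma ip_conj (u v : V) : ip u v = conjc (ip v u).
Proof. by case: ipP. Qed.

Lemma ipDl (u v w : V) : ip (u + v) w = ip u w + ip v w.
Proof. by rewrite -[u]scale1r ip_linearl mul1r scale1r. Qed.

Lemma ip0l (w : V) : ip 0 w = 0.
Proof. by apply: (addIr (ip 0 w)); rewrite -ipDl addr0 add0r. Qed.

Lemma ipZl (c : R[i]) (u w : V) : ip (c *: u) w = c * ip u w.
Proof. by rewrite -[_ *: _]addr0 ip_linearl ip0l addr0. Qed.

Lemma ipDr (w u v : V) : ip w (u + v) = ip w u + ip w v.
Proof. by rewrite ip_conj ipDl rmorphD /= -!ip_conj. Qed.

Lemma ipZr (c : R[i]) (w u : V) : ip w (c *: u) = conjc c * ip w u.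
Proof. by rewrite ip_conj ipZl rmorphM /= -ip_conj. Qed.

Lemma ip_suml (I : finType) (F : I -> V) (w : V) :
  ip (\sum_i F i) w = \sum_i ip (F i) w.
Proof. exact: (big_morph (fun u => ip u w) (fun u v => ipDl u v w) (ip0l w)). Qed.

Lemma ipvv (v : V) : ip v v = (nm v ^+ 2)%:C%C.
Proof.
have [_ _ /(_ v) + _] := ipP; rewrite /hnorm; case: (ip v v) => x y.
by rewrite lecE /= => /andP[/eqP -> x0]; rewrite sqr_sqrtr.
Qed.

Lemma hnorm_ge0 (v : V) : 0 <= nm v.
Proof. exact: sqrtr_ge0. Qed.

Lemma hnorm_eq0 (v : V) : nm v = 0 -> v = 0.
Proof. by move=> v0; have [_ _ _] := ipP; apply; rewrite ipvv v0 expr0n. Qed.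

Lemma hnorm0 : nm 0 = 0.
Proof. by rewrite /hnorm ip0l sqrtr0. Qed.

Lemma hnormZ (c : R[i]) (v : V) : nm (c *: v) = cabs c * nm v.
Proof.
apply/eqP; rewrite -(@eqrXn2 _ 2) ?mulr_ge0 ?hnorm_ge0 ?cabs_ge0 //; apply/eqP.
apply: (@complexI R); rewrite exprMn -ipvv ipZl ipZr ipvv mulrA -sqr_normc.
by rewrite normr_cabs -rmorphXn -rmorphM.
Qed.

Lemma hnormN (v : V) : nm (- v) = nm v.
Proof. by rewrite -scaleN1r hnormZ /cabs normrN normr1 mul1r. Qed.

(** Positivity of the squared norm of B u - b v, with b = <u,v> and B = <v,v>: it equals B (B <u,u>
    - |b|^2). *)
Lemma cauchy_schwarz (u v : V) : cabs (ip u v) <= nm u * nm v.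
Proof.
have [v0|vn0] := eqVneq (nm v) 0.
  by rewrite (hnorm_eq0 v0) ip_conj ip0l hnorm0 mulr0 conjc0 /cabs normr0.
have vp : 0 < nm v by rewrite lt_def vn0 hnorm_ge0.
set b := ip u v; set B := ip v v; have BE : B = (nm v ^+ 2)%:C%C := ipvv v.
have := ipvv (B *: u + (- b) *: v).
have -> : ip (B *: u + (- b) *: v) (B *: u + (- b) *: v)
    = B * (B * ip u u - b * conjc b).
  rewrite !(ipDl, ipDr, ipZl, ipZr) -/b -/B (ip_conj v u) -/b rmorphN /=.
  by rewrite BE conjc_real; ring.
rewrite -sqr_normc normr_cabs BE !ipvv => eqs.
have : 0 <= nm v ^+ 2 * (nm v ^+ 2 * nm u ^+ 2 - cabs b ^+ 2).
  have <- : nm (B *: u + (- b) *: v) ^+ 2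
      = nm v ^+ 2 * (nm v ^+ 2 * nm u ^+ 2 - cabs b ^+ 2).
    apply: (@complexI R).
    by rewrite BE -eqs !rmorphM /= rmorphB /= rmorphM /= !rmorphXn.
  exact: sqr_ge0.
rewrite pmulr_rge0 ?exprn_gt0 // subr_ge0 -exprMn [nm v * _]mulrC.
by rewrite ler_pXn2r // ?nnegrE ?mulr_ge0 ?hnorm_ge0 ?cabs_ge0.
Qed.

Lemma hnormD (u v : V) : nm (u + v) <= nm u + nm v.
Proof.
rewrite -(@ler_pXn2r _ 2) ?nnegrE ?addr_ge0 ?hnorm_ge0 //.
have -> : nm (u + v) ^+ 2 = nm u ^+ 2 + nm v ^+ 2 + 2 * complex.Re (ip u v).
  have := ipvv (u + v); rewrite ipDl !ipDr !ipvv (ip_conj v u).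
  case: (ip u v) => x y /(congr1 (@complex.Re R)) /= <-; ring.
have : complex.Re (ip u v) <= nm u * nm v.
  apply: le_trans (cauchy_schwarz u v); apply: le_trans (ler_norm _) _.
  by rewrite -lecR -normr_cabs normc_ge_Re.
by move=> ?; nra.
Qed.

Lemma hnorm_sum (I : finType) (F : I -> V) : nm (\sum_i F i) <= \sum_i nm (F i).
Proof.
elim/big_ind2: _ => [|x1 x2 y1 y2 xx yy|//]; first by rewrite hnorm0.
exact: le_trans (hnormD _ _) (lerD xx yy).
Qed.

(** Turns scalar estimates into norm estimates: testing u against itself suffices, since <u,u> =
    ||u||^2. *)
Lemma hnorm_le_dual (u : V) (M : R) :
  cabs (ip u u) <= M * nm u -> 0 <= M -> nm u <= M.
Proof.
have [->//|u0] := eqVneq (nm u) 0.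
have up : 0 < nm u by rewrite lt_def u0 hnorm_ge0.
by rewrite ipvv cabs_real ?sqr_ge0 // expr2 ler_pM2r.
Qed.

End InnerProduct.

(** * Consequences of linearity *)

Section LinearMaps.
Variables (C : nzRingType) (V : lmodType C) (T : V -> V).
Hypothesis TP : forall (c : C) (u v : V), T (c *: u + v) = c *: T u + T v.

Lemma lin0 : T 0 = 0.
Proof. by apply: (addIr (T 0)); have := TP 1 0 0; rewrite !scale1r addr0 add0r. Qed.

Lemma linD (u v : V) : T (u + v) = T u + T v.
Proof. by have := TP 1 u v; rewrite !scale1r. Qed.

Lemma linZ (c : C) (u : V) : T (c *: u) = c *: T u.
Proof. by have := TP c u 0; rewrite lin0 !addr0. Qed.

Lemma lin_sum (I : finType) (F : I -> V) : T (\sum_i F i) = \sum_i T (F i).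
Proof. exact: (big_morph T linD lin0). Qed.

End LinearMaps.

(** * Row operators and the homogeneous terms of a free power series *)

Section Rows.
Variables (R : realType) (V : lmodType R[i]) (ip : V -> V -> R[i]).
Hypothesis ipP : is_inner_product ip.
Local Notation nm := (hnorm ip).
Implicit Types (n : nat) (h v : V).

(** A bound on the row operator that avoids the supremum, which is informative only for a set
    bounded above. *)
Definition row_bounded n (r : R) (X : 'I_n -> V -> V) :=
  forall h : 'I_n -> V, \sum_(i < n) nm (h i) ^+ 2 <= 1 ->
    nm (\sum_(i < n) X i (h i)) <= r.

Lemma zero_row_sqr n : \sum_(i < n) nm ((fun=> 0) i) ^+ 2 <= 1.
Proof. by rewrite big1 // => i _; rewrite hnorm0 // expr0n. Qed.

Lemma row_bounded_ge0 n r (X : 'I_n -> V -> V) : row_bounded r X -> 0 <= r.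
Proof. by move=> /(_ _ (zero_row_sqr n)); apply: le_trans; exact: hnorm_ge0. Qed.

Lemma rownorm_le n (r : R) (X : 'I_n -> V -> V) : row_bounded r X -> rownorm ip X <= r.
Proof.
move=> rX; apply: ge_sup; last by move=> _ [h [h1 ->]]; exact: rX.
by exists (nm (\sum_(i < n) X i 0)), (fun=> 0); split => //; exact: zero_row_sqr.
Qed.

Lemma row_entry_le1 n (h : 'I_n -> V) (j : 'I_n) :
  \sum_(i < n) nm (h i) ^+ 2 <= 1 -> nm (h j) <= 1.
Proof.
move=> h1; rewrite -(@expr_le1 _ 2) ?hnorm_ge0 //; apply: le_trans h1.
by rewrite (bigD1 j) //= lerDl; apply: sumr_ge0 => i _; exact: sqr_ge0.
Qed.

(** Boundedness of the entries makes the set behind [rownorm] bounded above, so that its supremum is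
    a genuine bound. *)
Lemma row_bounded_rownorm n (X : 'I_n -> V -> V) :
  (forall i, bounded_op ip (X i)) -> row_bounded (rownorm ip X) X.
Proof.
move=> Xb h h1; apply: ub_le_sup; last by exists h.
have /choice[M XM] : forall i, exists M : R, forall v, nm (X i v) <= M * nm v.
  by move=> i; case: (Xb i).
exists (\sum_i `|M i|) => _ [g [g1 ->]].
apply: le_trans (hnorm_sum ipP _) _; apply: ler_sum => i _.
apply: le_trans (XM i _) _; apply: (@le_trans _ _ (`|M i| * nm (g i))).
  by rewrite ler_wpM2r ?hnorm_ge0 ?ler_norm.
by rewrite ler_piMr // row_entry_le1.
Qed.

(** Homogeneity extends the bound from the unit ball to all rows: divide h by its norm when that is
    nonzero. *)
Lemma row_bounded_sqr n (r : R) (X : 'I_n -> V -> V) (h : 'I_n -> V) :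
  (forall i, bounded_op ip (X i)) -> row_bounded r X ->
  nm (\sum_(i < n) X i (h i)) ^+ 2 <= r ^+ 2 * \sum_(i < n) nm (h i) ^+ 2.
Proof.
move=> Xb rX; set S := \sum_(i < n) _ ^+ 2.
have S0 : 0 <= S by apply: sumr_ge0 => i _; exact: sqr_ge0.
have [Sz|Sn0] := eqVneq S 0.
  rewrite big1 ?hnorm0 ?Sz ?mulr0 ?expr0n // => i _.
  have /eqP := Sz; rewrite psumr_eq0 => [/allP/(_ i)|j _]; last exact: sqr_ge0.
  rewrite mem_index_enum expf_eq0 /= => /(_ isT)/eqP/(hnorm_eq0 ipP) ->.
  exact: lin0 (Xb i).1.
have Sp : 0 < S by rewrite lt_def Sn0.
pose s := Num.sqrt S; have sp : 0 < s by rewrite sqrtr_gt0.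
have ss : s ^+ 2 = S by rewrite sqr_sqrtr.
pose c : R[i] := (s^-1)%:C%C.
have cE : cabs c = s^-1 by rewrite cabs_real // invr_ge0 ltW.
have := rX (fun i => c *: h i).
have -> : \sum_(i < n) nm (c *: h i) ^+ 2 = 1.
  under eq_bigr do rewrite hnormZ // cE exprMn.
  by rewrite -mulr_sumr -/S -ss -exprMn mulVf ?expr1n // gt_eqF.
have -> : \sum_(i < n) X i (c *: h i) = c *: \sum_(i < n) X i (h i).
  by rewrite scaler_sumr; apply: eq_bigr => i _; rewrite (linZ (Xb i).1).
rewrite hnormZ // cE => /(_ (lexx _)); rewrite ler_pdivrMl // => H.
rewrite -ss -exprMn [r * s]mulrC ler_pXn2r // ?nnegrE ?hnorm_ge0 //.
exact: le_trans (hnorm_ge0 _ _) H.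
Qed.

Lemma sum_tuple0 (T : finType) (W : nmodType) (F : 0.-tuple T -> W) :
  \sum_(w : 0.-tuple T) F w = F [tuple].
Proof. by rewrite (bigD1 [tuple]) //= big1 ?addr0 // => w; rewrite tuple0. Qed.

Lemma sum_tuple_cons (T : finType) (W : nmodType) k (F : k.+1.-tuple T -> W) :
  \sum_(w : k.+1.-tuple T) F w
    = \sum_(i : T) \sum_(w : k.-tuple T) F [tuple of i :: w].
Proof.
rewrite pair_big /=.
rewrite (reindex (fun p : T * k.-tuple T => [tuple of p.1 :: p.2])) //=.
exists (fun w : k.+1.-tuple T => (thead w, [tuple of behead w])) => [[i w] _|w _] /=.
  by rewrite theadE; congr pair; apply: val_inj.
by rewrite -tuple_eta.
Qed.

Lemma Xword_lin n (X : 'I_n -> V -> V) (w : seq 'I_n) :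
  (forall i, bounded_op ip (X i)) ->
  forall (c : R[i]) u v, Xword X w (c *: u + v) = c *: Xword X w u + Xword X w v.
Proof.
by move=> Xb c u v; elim: w => //= i w IH; rewrite IH (Xb i).1.
Qed.

(** The row of all [Xword X w] with |w| = k has norm at most r^k: split off the first letter and
    apply the row bound to the n vectors produced by the remaining letters. *)
Lemma words_sqr n (r : R) (X : 'I_n -> V -> V) k (h : k.-tuple 'I_n -> V) :
  (forall i, bounded_op ip (X i)) -> row_bounded r X ->
  nm (\sum_(w : k.-tuple 'I_n) Xword X w (h w)) ^+ 2 <= (r ^+ k) ^+ 2 * \sum_w nm (h w) ^+ 2.
Proof.
move=> Xb rX; elim: k h => [|k IH] h.
  by rewrite !sum_tuple0 expr0 expr1n mul1r.
rewrite !sum_tuple_cons /=.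
have -> : \sum_i \sum_(w : k.-tuple 'I_n)
      (X i \o foldr (fun j f => X j \o f) id w) (h [tuple of i :: w])
    = \sum_i X i (\sum_(w : k.-tuple 'I_n) Xword X w (h [tuple of i :: w])).
  by apply: eq_bigr => i _; rewrite (lin_sum (Xb i).1).
apply: le_trans (row_bounded_sqr _ Xb rX) _.
rewrite [r ^+ k.+1]exprS exprMn -[X in _ <= X]mulrA.
apply: ler_wpM2l; rewrite ?sqr_ge0 // mulr_sumr.
by apply: ler_sum => i _; exact: IH.
Qed.

Definition hterm n (a : seq 'I_n -> R[i]) (X : 'I_n -> V -> V) (k : nat) h : V :=
  \sum_(w : k.-tuple 'I_n) a w *: Xword X w h.

(** The l2 norm of the coefficients of degree k; for k > 0 its k-th root is the quantity in
    [free_holo_coeffs]. *)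
Definition coefnorm n (a : seq 'I_n -> R[i]) (k : nat) : R :=
  Num.sqrt (\sum_(w : k.-tuple 'I_n) cabs (a w) ^+ 2).

Lemma coefnorm_ge0 n (a : seq 'I_n -> R[i]) k : 0 <= coefnorm a k.
Proof. exact: sqrtr_ge0. Qed.

Lemma fh_partialE n (a : seq 'I_n -> R[i]) X N h :
  fh_partial a X N h = \sum_(k < N) hterm a X k h.
Proof. by []. Qed.

Lemma hterm_lin n (a : seq 'I_n -> R[i]) X k :
  (forall i, bounded_op ip (X i)) ->
  forall (c : R[i]) u v, hterm a X k (c *: u + v) = c *: hterm a X k u + hterm a X k v.
Proof.
move=> Xb c u v; rewrite scaler_sumr -big_split; apply: eq_bigr => w _.
by rewrite (Xword_lin _ Xb) scalerDr !scalerA mulrC.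
Qed.

(** The scalars are moved onto the vector, so that [words_sqr] applies to the family a_w h. *)
Lemma hterm_le n (r : R) (a : seq 'I_n -> R[i]) X k h :
  (forall i, bounded_op ip (X i)) -> row_bounded r X ->
  nm (hterm a X k h) <= coefnorm a k * r ^+ k * nm h.
Proof.
move=> Xb rX; have r0 := row_bounded_ge0 rX.
rewrite -(@ler_pXn2r _ 2) ?nnegrE ?mulr_ge0 ?exprn_ge0 ?coefnorm_ge0 ?hnorm_ge0 //.
have -> : hterm a X k h = \sum_(w : k.-tuple 'I_n) Xword X w (a w *: h).
  by apply: eq_bigr => w _; rewrite (linZ (Xword_lin _ Xb)).
apply: le_trans (words_sqr _ Xb rX) _.
under eq_bigr do rewrite hnormZ // exprMn.
rewrite -mulr_suml 2!exprMn [coefnorm a k ^+ 2]sqr_sqrtr; last first.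
  by apply: sumr_ge0 => w _; exact: sqr_ge0.
by rewrite mulrA [X in X * _]mulrC.
Qed.

(** This is what makes z |-> F(zX) a power series in z. *)
Lemma htermZ n (a : seq 'I_n -> R[i]) (X : 'I_n -> V -> V) (c : R[i]) k h :
  (forall i, bounded_op ip (X i)) ->
  hterm a (fun i v => c *: X i v) k h = c ^+ k *: hterm a X k h.
Proof.
move=> Xb; rewrite scaler_sumr; apply: eq_bigr => w _.
rewrite scalerA mulrC -scalerA; congr (_ *: _).
have <- : c ^+ size w = c ^+ k by rewrite size_tuple.
elim: (tval w) => [|i s IH] /=.
  by rewrite expr0 scale1r.
by rewrite IH (linZ (Xb i).1) scalerA -exprS.
Qed.

Lemma hterm1 n (a : seq 'I_n -> R[i]) (X : 'I_n -> V -> V) h :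
  hterm a X 1 h = \sum_(i < n) a [:: i] *: X i h.
Proof. by rewrite /hterm sum_tuple_cons; apply: eq_bigr => i _; rewrite sum_tuple0. Qed.

Lemma bounded_opZ (c : R[i]) (T : V -> V) :
  bounded_op ip T -> bounded_op ip (fun v => c *: T v).
Proof.
move=> [Tl [M TM]]; split=> [b u v|]; first by rewrite Tl scalerDr !scalerA mulrC.
by exists (cabs c * M) => v; rewrite hnormZ // -mulrA ler_wpM2l ?cabs_ge0.
Qed.

Lemma row_boundedZ n (r : R) (c : R[i]) (X : 'I_n -> V -> V) :
  row_bounded r X -> row_bounded (cabs c * r) (fun i v => c *: X i v).
Proof.
by move=> rX h h1; rewrite -scaler_sumr hnormZ // ler_wpM2l ?cabs_ge0 // rX.
Qed.

End Rows.

(** * Polynomials with vector coefficients *)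

Section VectorPolynomials.
Variables (R : realType) (V : lmodType R[i]) (ip : V -> V -> R[i]).
Hypothesis ipP : is_inner_product ip.
Local Notation nm := (hnorm ip).

(** Paired with [c i], the polynomial becomes a scalar one, bounded on the circle by M ||c_i||,
    whose coefficient of index i is ||c_i||^2. *)
Lemma hpoly_coef_le (c : nat -> V) (N : nat) (M : R) (i : nat) :
  (forall z : R[i], `|z| = 1 -> nm (\sum_(k < N) z ^+ k *: c k) <= M) ->
  (i < N)%N -> nm (c i) <= M.
Proof.
move=> cM iN; have M0 : 0 <= M by apply: le_trans (cM 1 (normr1 _)); exact: hnorm_ge0.
apply: (hnorm_le_dual ipP) => //; rewrite -lecR -normr_cabs.
pose p := \poly_(k < N) ip (c k) (c i).
have <- : p`_i = ip (c i) (c i) by rewrite coef_poly iN.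
apply: coef_le_circle => z z1; rewrite horner_poly.
have -> : \sum_(k < N) ip (c k) (c i) * z ^+ k = ip (\sum_(k < N) z ^+ k *: c k) (c i).
  by rewrite ip_suml //; apply: eq_bigr => k _; rewrite ipZl // mulrC.
rewrite normr_cabs lecR; apply: le_trans (cauchy_schwarz ipP _ _) _.
by apply: ler_wpM2r; [exact: hnorm_ge0|exact: cM].
Qed.

(* Schwarz's lemma: divide the scalar polynomial by z, which has modulus one on
   the circle, before applying the maximum principle. *)
Lemma hpoly_schwarz (c : nat -> V) (N : nat) (M s : R) :
  (forall z : R[i], `|z| = 1 -> nm (\sum_(k < N) z ^+ k *: c k) <= M) ->
  c 0 = 0 -> 0 <= s <= 1 -> nm (\sum_(k < N) s%:C%C ^+ k *: c k) <= s * M.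
Proof.
move=> cM c0 /andP[s0 s1].
have M0 : 0 <= M by apply: le_trans (cM 1 (normr1 _)); exact: hnorm_ge0.
set v := \sum_(k < N) s%:C%C ^+ k *: c k.
apply: (hnorm_le_dual ipP); last exact: mulr_ge0.
case: N => [|N] in cM v *; first by rewrite /v big_ord0 ip0l // hnorm0 // mulr0 /cabs normr0.
pose p := \poly_(k < N) ip (c k.+1) v.
have pE z : z * p.[z] = ip (\sum_(k < N.+1) z ^+ k *: c k) v.
  rewrite big_ord_recl c0 scaler0 add0r ip_suml // horner_poly mulr_sumr.
  by apply: eq_bigr => k _; rewrite ipZl // lift0 exprS -mulrA [_ * z ^+ k]mulrC.
rewrite -[X in ip X v]/(\sum_(k < N.+1) s%:C%C ^+ k *: c k) -pE cabsM cabs_real //.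
rewrite -mulrA; apply: ler_wpM2l => //; rewrite -lecR -normr_cabs.
apply: horner_le_circle => [z z1|]; last by rewrite normr_cabs cabs_real // lecR.
rewrite -[`|_|]mul1r -z1 -normrM pE normr_cabs lecR.
apply: le_trans (cauchy_schwarz ipP _ _) _.
by apply: ler_wpM2r; [exact: hnorm_ge0|exact: cM].
Qed.

End VectorPolynomials.

(** * Growth of the coefficients *)

Section Coefficients.
Import numFieldNormedType.Exports.
Local Open Scope classical_set_scope.
Variables (R : realType) (n : nat) (a : seq 'I_n -> R[i]) (q : R).
Hypotheses (aP : free_holo_coeffs a) (q0 : 0 <= q) (q1 : q < 1).

(** Root test: the limit superior is an infimum of tail suprema and lies below b, so some tail stays
    below b. *)
Lemma coefnorm_le_expr (b : R) :
  1 < b -> exists K : nat, forall k, (K <= k)%N -> coefnorm a k <= b ^+ k.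
Proof.
move=> b1; have b0 : 0 < b := lt_trans ltr01 b1.
have b1E : (1%:E < b%:E)%E by rewrite lte_fin.
have /ereal_inf_lt[_ [W [K _ KW] <-] Wb] := le_lt_trans aP b1E.
exists K.+1 => k Kk; have k0 : (0 < k)%N by exact: leq_ltn_trans Kk.
have : ((powR (\sum_(w : k.-tuple 'I_n) cabs (a w) ^+ 2) (k.*2%:R^-1))%:E < b%:E)%E.
  apply: le_lt_trans Wb; apply: ereal_sup_ubound; exists k => //.
  by apply: KW; exact: ltnW.
rewrite lte_fin /coefnorm.
set S := \sum_(w : _) _ => /ltW Sb.
have S0 : 0 <= S by apply: sumr_ge0 => w _; exact: sqr_ge0.
have kn0 : k.*2%:R != 0 :> R by rewrite pnatr_eq0 double_eq0 -lt0n.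
rewrite -(@ler_pXn2r _ 2) ?nnegrE ?sqrtr_ge0 ?exprn_ge0 ?(ltW b0) // sqr_sqrtr //.
rewrite -exprM muln2 -(powRr1 S0) -(mulVf kn0) powRrM powR_mulrn ?powR_ge0 //.
by apply: lerXn2r; rewrite ?nnegrE ?powR_ge0 // ltW.
Qed.

Lemma geometric_tail (t : R) : 0 <= t -> t < 1 -> forall e : R, 0 < e ->
  exists K : nat, forall N N', (K <= N)%N -> \sum_(N <= k < N') t ^+ k <= e.
Proof.
move=> t0 t1 e e0; have s0 : 0 < 1 - t by rewrite subr_gt0.
have : (fun k => t ^+ k) @ \oo --> (0 : R) by apply: cvg_expr; rewrite ger0_norm.
move/cvgrPdist_lt => /(_ _ (mulr_gt0 e0 s0))[K _ KP].
exists K => N N' KN; have [NN|NN] := leqP N N'; last first.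
  by rewrite (big_geq (ltnW NN)); exact: ltW.
(* Multiplied by 1 - t, the sum telescopes to t^N - t^N'. *)
rewrite -(ler_pM2r s0) mulr_suml.
under eq_bigr => k _ do rewrite mulrBr mulr1 -exprSr -[_ - _]opprB.
rewrite sumrN telescope_sumr // opprB.
have := KP N KN; rewrite sub0r normrN ger0_norm ?exprn_ge0 // => /ltW; apply: le_trans.
by rewrite lerBlDr lerDl exprn_ge0.
Qed.

Lemma coef_tail (e : R) : 0 < e -> exists K : nat, forall N N', (K <= N)%N ->
  \sum_(N <= k < N') coefnorm a k * q ^+ k <= e.
Proof.
(* This b satisfies both b > 1 and b q < 1, so q^k absorbs the coefficient growth b^k. *)
move=> e0; pose b := 2 / (1 + q).
have d0 : 0 < 1 + q by rewrite ltr_pwDl.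
have b1 : 1 < b by rewrite ltr_pdivlMr // mul1r -[2]/(1 + 1) ltrD2l.
have bq0 : 0 <= b * q by rewrite mulr_ge0 // ltW // (lt_trans ltr01).
have bq1 : b * q < 1 by rewrite mulrAC ltr_pdivrMr // mul1r mulr_natl mulr2n ltrD2r.
have [K KP] := coefnorm_le_expr b1; have [K' K'P] := geometric_tail bq0 bq1 e0.
exists (maxn K K') => N N'; rewrite geq_max => /andP[KN KN'].
apply: le_trans (K'P N N' KN'); apply: ler_sum_nat => k /andP[Nk _].
rewrite exprMn ler_wpM2r ?exprn_ge0 // KP //; exact: leq_trans Nk.
Qed.

End Coefficients.

(** * Evaluation at a tuple: convergence of the partial sums in operator norm *)

Section FunctionalCalculus.
Variables (R : realType) (V : lmodType R[i]) (ip : V -> V -> R[i]).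
Hypothesis ipP : is_inner_product ip.
Local Notation nm := (hnorm ip).
Variables (n : nat) (a : seq 'I_n -> R[i]) (X : 'I_n -> V -> V) (r : R).
Hypotheses (Xb : forall i, bounded_op ip (X i)) (rX : row_bounded ip r X).

Lemma fh_partial_lin (N : nat) (c : R[i]) (u v : V) :
  fh_partial a X N (c *: u + v) = c *: fh_partial a X N u + fh_partial a X N v.
Proof.
rewrite !fh_partialE scaler_sumr -big_split; apply: eq_bigr => k _.
exact: hterm_lin Xb _ _ _.
Qed.

Lemma fh_partial_diff (N N' : nat) (h : V) : (N <= N')%N ->
  nm (fh_partial a X N' h - fh_partial a X N h)
    <= (\sum_(N <= k < N') coefnorm a k * r ^+ k) * nm h.
Proof.
move=> NN; rewrite !fh_partialE -!(big_mkord xpredT (fun k => hterm a X k h)).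
rewrite (big_cat_nat (leq0n N) NN) /= addrAC subrr add0r.
rewrite big_nat mulr_suml [X in _ <= X]big_nat.
elim/big_ind2: _ => [|x1 x2 y1 y2 xx yy|k _]; first by rewrite hnorm0.
  exact: le_trans (hnormD _ _ _) (lerD xx yy).
exact: hterm_le.
Qed.

Lemma fh_partial_bounded (N : nat) : bounded_op ip (fh_partial a X N).
Proof.
split; first exact: fh_partial_lin.
exists (\sum_(0 <= k < N) coefnorm a k * r ^+ k) => v.
by have := fh_partial_diff v (leq0n N); rewrite [fh_partial a X 0 v]big_ord0 subr0.
Qed.

Lemma bounded_opB (S T : V -> V) : bounded_op ip S -> bounded_op ip T ->
  bounded_op ip (fun h => S h - T h).
Proof.
move=> [Sl [M SM]] [Tl [M' TM]]; split => [c u v|].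
  by rewrite Sl Tl scalerBr opprD addrACA.
exists (M + M') => v; apply: le_trans (hnormD ipP _ _) _.
by rewrite hnormN // mulrDl lerD.
Qed.

Lemma opnorm_le (T : V -> V) (e : R) :
  (forall h, nm h <= 1 -> nm (T h) <= e) -> opnorm ip T <= e.
Proof.
move=> Te; apply: ge_sup => [|_ [h [h1 ->]]]; last exact: Te.
by exists (nm (T 0)), 0; rewrite hnorm0.
Qed.

Lemma le_opnorm (T : V -> V) (h : V) : bounded_op ip T -> nm h <= 1 ->
  nm (T h) <= opnorm ip T.
Proof.
move=> [_ [M TM]] h1; apply: ub_le_sup; last by exists h.
exists `|M| => _ [g [g1 ->]]; apply: le_trans (TM _) _.
apply: (@le_trans _ _ (`|M| * nm g)); first by rewrite ler_wpM2r ?hnorm_ge0 ?ler_norm.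
by rewrite ler_piMr.
Qed.

Lemma fh_value_cvg (T : V -> V) : fh_value ip a X T -> forall e : R, 0 < e ->
  exists K : nat, forall N h, (K <= N)%N -> nm h <= 1 -> nm (fh_partial a X N h - T h) <= e.
Proof.
move=> [Tb Tlim] e e0; have [K KP] := Tlim e e0; exists K => N h KN h1.
apply/ltW; apply: le_lt_trans (KP N KN).
by apply: (le_opnorm _ h1); apply: bounded_opB => //; exact: fh_partial_bounded.
Qed.

Hypotheses (complV : hilbert_complete ip) (aP : free_holo_coeffs a) (r1 : r < 1).

(* The rate of convergence only involves r and the coefficients, so that it is the
   same for all tuples with row bound r. *)
Lemma fh_value_exists : exists2 T, fh_value ip a X T &
  forall (e : R) (K : nat),
    (forall N N', (K <= N)%N -> \sum_(N <= k < N') coefnorm a k * r ^+ k <= e) ->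
    forall N h, (K <= N)%N -> nm (fh_partial a X N h - T h) <= e * nm h.
Proof.
have r0 := row_bounded_ge0 ipP rX.
have tail := coef_tail aP r0 r1.
have near_diff (e : R) K N N' h :
    (forall N N', (K <= N)%N -> \sum_(N <= k < N') coefnorm a k * r ^+ k <= e) ->
    (K <= N)%N -> (K <= N')%N ->
    nm (fh_partial a X N' h - fh_partial a X N h) <= e * nm h.
  move=> Ke; wlog NN : N N' / (N <= N')%N => [H KN KN'|KN _].
    by case/orP: (leq_total N N') => NN; [|rewrite -opprB hnormN //]; exact: H.
  apply: le_trans (fh_partial_diff _ NN) _.
  by apply: ler_wpM2r; [exact: hnorm_ge0|exact: Ke].
have /choice[T TP] : forall h, exists v : V, forall e : R, 0 < e ->
    exists N, forall k, (N <= k)%N -> nm (fh_partial a X k h - v) < e.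
  move=> h; apply: complV => e e0.
  have h0 : 0 < nm h + 1 by rewrite ltr_wpDl ?hnorm_ge0.
  have [K KP] := tail _ (divr_gt0 e0 h0); exists K => k l Kk Kl.
  apply: le_lt_trans (near_diff _ K l k h KP Kl Kk) _.
  by rewrite mulrAC ltr_pdivrMr // ltr_pM2l // ltrDl.
have rate (e : R) K :
    (forall N N', (K <= N)%N -> \sum_(N <= k < N') coefnorm a k * r ^+ k <= e) ->
    forall N h, (K <= N)%N -> nm (fh_partial a X N h - T h) <= e * nm h.
  (* Compare through a later partial sum lying within d of T h, with d arbitrary. *)
  move=> Ke N h KN; apply/ler_addgt0Pr => d d0; have [L LP] := TP h d d0.
  rewrite -(subrKA (fh_partial a X (maxn K L) h)).
  apply: le_trans (hnormD ipP _ _) _; apply: lerD.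
    by apply: near_diff Ke _ KN; exact: leq_maxl.
  by apply/ltW/LP; exact: leq_maxr.
exists T => //; split; last first.
  move=> e e0; have e20 : 0 < e / 2 by rewrite divr_gt0.
  have [K KP] := tail _ e20; exists K => N KN.
  apply: (@le_lt_trans _ _ (e / 2)); last by rewrite ltr_pdivrMr // ltr_pMr // ltr1n.
  apply: opnorm_le => h h1; apply: le_trans (rate _ _ KP N h KN) _.
  by rewrite ler_piMr // ltW.
split=> [c u v|].
  (* Linearity passes to the limit: the defect combines three approximation errors, of total norm at
     most e B <= d. *)
  apply/eqP; rewrite -subr_eq0; apply/eqP; apply: (hnorm_eq0 ipP).
  apply/eqP; rewrite eq_le hnorm_ge0 andbT; apply/ler_addgt0Pr => d d0; rewrite add0r.
  set B := nm (c *: u + v) + cabs c * nm u + nm v.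
  have B0 : 0 < B + 1 by rewrite ltr_wpDl // !addr_ge0 ?mulr_ge0 ?cabs_ge0 ?hnorm_ge0.
  have [K KP] := tail _ (divr_gt0 d0 B0); have {}KP := fun h => rate _ _ KP K h (leqnn K).
  set e := d / (B + 1) in KP.
  apply: (@le_trans _ _ (e * B)); last first.
    by rewrite mulrAC ler_pdivrMr // ler_pM2l // lerDl.
  have -> : T (c *: u + v) - (c *: T u + T v)
      = - (fh_partial a X K (c *: u + v) - T (c *: u + v))
        + (c *: (fh_partial a X K u - T u) + (fh_partial a X K v - T v)).
    rewrite fh_partial_lin scalerBr opprB.
    by rewrite [_ + (fh_partial a X K v - T v)]addrACA -opprD subrKA.
  rewrite !mulrDr -addrA; apply: le_trans (hnormD ipP _ _) _; rewrite hnormN //.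
  apply: lerD => //; apply: le_trans (hnormD ipP _ _) _; rewrite hnormZ //.
  by apply: lerD => //; rewrite mulrCA ler_wpM2l ?cabs_ge0.
(* T is bounded because it lies within distance 1 of a bounded partial sum. *)
have [K KP] := tail _ ltr01; have [_ [M MP]] := fh_partial_bounded K.
exists (1 + M) => h; rewrite -[T h](subrK (fh_partial a X K h)) mulrDl.
apply: le_trans (hnormD ipP _ _) _; apply: lerD => //.
by rewrite -opprB hnormN //; exact: rate KP _ _ (leqnn K).
Qed.

End FunctionalCalculus.

(** * Row norm estimates for F through power series in one variable *)

Section Schwarz.
Variables (R : realType) (V : lmodType R[i]) (ip : V -> V -> R[i]).
Variables (n m : nat) (a : 'I_m -> seq 'I_n -> R[i]).
Hypotheses (ipP : is_inner_product ip) (complV : hilbert_complete ip).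
Hypothesis aP : forall j, free_holo_coeffs (a j).
Hypothesis aF : forall X : 'I_n -> V -> V, (forall i, bounded_op ip (X i)) ->
  rownorm ip X < 1 -> forall T : 'I_m -> V -> V, (forall j, fh_value ip (a j) X (T j)) ->
  rownorm ip T < 1.
Local Notation nm := (hnorm ip).

(** The coefficient C_k of z^k in the expansion of sum_j F_j(zX) h_j. *)
Definition rowterm (X : 'I_n -> V -> V) (h : 'I_m -> V) (k : nat) : V :=
  \sum_(j < m) hterm (a j) X k (h j).

Lemma sum_rowterm X h N :
  \sum_(k < N) rowterm X h k = \sum_(j < m) fh_partial (a j) X N (h j).
Proof. exact: exchange_big. Qed.

Lemma rowtermZ X (c : R[i]) h k : (forall i, bounded_op ip (X i)) ->
  rowterm (fun i v => c *: X i v) h k = c ^+ k *: rowterm X h k.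
Proof.
move=> Xb; rewrite scaler_sumr; apply: eq_bigr => j _; exact: htermZ Xb.
Qed.

Lemma rowsum_dist (S T : 'I_m -> V) (e : R) :
  (forall j, nm (S j - T j) <= e / m.+1%:R) -> 0 < e ->
  nm (\sum_(j < m) S j - \sum_(j < m) T j) <= e.
Proof.
move=> ST e0; rewrite -sumrB; apply: le_trans (hnorm_sum ipP _) _.
apply: le_trans (ler_sum _ (fun j _ => ST j)) _.
rewrite sumr_const card_ord -[X in X <= _]mulr_natr mulrAC ler_pdivrMr ?ltr0Sn //.
by rewrite ler_wpM2l ?ler_nat // ltW.
Qed.

(** For |z| = 1 the tuple zY keeps the row bound q < 1, so F(zY) has row norm below 1, and the
    partial sum at zY is within e of it on h. The index K is fixed before z, as the tails depend
    only on q and the coefficients. *)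
Lemma rowpoly_le (Y : 'I_n -> V -> V) (q : R) (h : 'I_m -> V) (e : R) :
  (forall i, bounded_op ip (Y i)) -> row_bounded ip q Y -> q < 1 ->
  \sum_(j < m) nm (h j) ^+ 2 <= 1 -> 0 < e ->
  exists K : nat, forall N, (K <= N)%N -> forall z : R[i], `|z| = 1 ->
    nm (\sum_(k < N) z ^+ k *: rowterm Y h k) <= 1 + e.
Proof.
move=> Yb qY q1 h1 e0; have q0 := row_bounded_ge0 ipP qY.
(* Dividing by [m.+1] rather than [m] also covers the empty row. *)
have em0 : 0 < e / m.+1%:R by rewrite divr_gt0.
have /choice[K KP] := fun j => coef_tail (aP j) q0 q1 em0.
exists (\max_j K j)%N => N KN z z1.
pose X := fun i v => z *: Y i v.
have Xb i : bounded_op ip (X i) by exact: bounded_opZ.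
have qX : row_bounded ip q X.
  by rewrite -[q]mul1r -(cabs_eq1 z1); exact: row_boundedZ.
have /choice[T TP] : forall j, exists T, fh_value ip (a j) X T /\
    nm (fh_partial (a j) X N (h j) - T (h j)) <= e / m.+1%:R.
  move=> j; have [T TV rate] := fh_value_exists ipP Xb qX complV (aP j) q1.
  exists T; split=> //.
  apply: le_trans (rate _ _ (KP j) N (h j) (leq_trans (leq_bigmax j) KN)) _.
  by rewrite ler_piMr ?(ltW em0) // row_entry_le1.
have -> : \sum_(k < N) z ^+ k *: rowterm Y h k
    = \sum_(j < m) fh_partial (a j) X N (h j).
  by rewrite -sum_rowterm; apply: eq_bigr => k _; rewrite rowtermZ.
rewrite -[X in nm X](subrK (\sum_j T j (h j))) addrC.
apply: le_trans (hnormD ipP _ _) _; apply: lerD; last first.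
  by apply: rowsum_dist => // j; case: (TP j).
have Tb j : bounded_op ip (T j) by case: (TP j) => -[].
apply: le_trans (row_bounded_rownorm ipP Tb h1) _; apply/ltW.
apply: (aF Xb); last by move=> j; case: (TP j).
exact: le_lt_trans (rownorm_le ipP qX) q1.
Qed.

Lemma scale_lt1 (X : 'I_n -> V -> V) (s : R) :
  (forall i, bounded_op ip (X i)) -> 0 < s -> rownorm ip X < s ->
  let Y := fun i v => (s^-1)%:C%C *: X i v in
  [/\ forall i, bounded_op ip (Y i), row_bounded ip (s^-1 * rownorm ip X) Y
    & s^-1 * rownorm ip X < 1].
Proof.
move=> Xb s0 rs Y; split; last by rewrite mulrC ltr_pdivrMr // mul1r.
- by move=> i; exact: bounded_opZ.
- rewrite -[s^-1]cabs_real ?invr_ge0 ?(ltW s0) //.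
  by apply: row_boundedZ => //; exact: row_bounded_rownorm.
Qed.

(** The Cauchy estimate at the rescaled tuple X / s bounds the coefficient of index 1 by 1; undoing
    the scaling multiplies the bound by s. *)
Lemma derivative_row_bounded (X : 'I_n -> V -> V) (s : R) :
  (forall i, bounded_op ip (X i)) -> 0 < s -> rownorm ip X < s ->
  row_bounded ip s (fun j h => \sum_(i < n) a j [:: i] *: X i h).
Proof.
move=> Xb s0 rs h h1; have [Yb qY q1] := scale_lt1 Xb s0 rs.
have -> : \sum_(j < m) \sum_(i < n) a j [:: i] *: X i (h j) = rowterm X h 1.
  by apply: eq_bigr => j _; rewrite hterm1.
have : nm (rowterm (fun i v => (s^-1)%:C%C *: X i v) h 1) <= 1.
  apply/ler_addgt0Pr => e e0; have [K KP] := rowpoly_le Yb qY q1 h1 e0.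
  (* At least two terms are kept, so that the coefficient of index 1 occurs. *)
  apply: (hpoly_coef_le (c := rowterm _ h) (N := maxn K 2) ipP); last by rewrite leq_maxr.
  exact: KP (leq_maxl _ _).
rewrite rowtermZ // hnormZ // expr1 cabs_real ?invr_ge0 ?(ltW s0) //.
by rewrite ler_pdivrMl // mulr1.
Qed.

(** F(X) is the value at z = s of the series of X / s, which has no constant term and is bounded by
    1 on the circle up to an arbitrarily small error. *)
Lemma schwarz_row_bounded (X T : _ -> V -> V) (s : R) :
  (forall j, a j [::] = 0) -> (forall i, bounded_op ip (X i)) ->
  0 < s <= 1 -> rownorm ip X < s ->
  (forall j, fh_value ip (a j) X (T j)) -> row_bounded ip s T.
Proof.
move=> a0 Xb /andP[s0 s1] rs TX h h1; have [Yb qY q1] := scale_lt1 Xb s0 rs.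
apply/ler_addgt0Pr => d d0; pose e := d / 2; have e0 : 0 < e by rewrite divr_gt0.
have [K KP] := rowpoly_le Yb qY q1 h1 e0.
have em0 : 0 < e / m.+1%:R by rewrite divr_gt0.
have rX := row_bounded_rownorm ipP Xb.
have /choice[L LP] := fun j => fh_value_cvg ipP Xb rX (TX j) em0.
pose N := maxn K (\max_j L j)%N.
rewrite -[X in nm X](subrK (\sum_j fh_partial (a j) X N (h j))) addrC.
have -> : s + d = s + e + e by rewrite -addrA -splitr.
apply: le_trans (hnormD ipP _ _) _; apply: lerD; last first.
  rewrite -opprB hnormN //; apply: rowsum_dist => // j.
  apply: LP; last exact: row_entry_le1 h1.
  by apply: leq_trans (leq_maxr _ _); exact: leq_bigmax.
pose c := rowterm (fun i v => (s^-1)%:C%C *: X i v) h.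
have -> : \sum_(j < m) fh_partial (a j) X N (h j) = \sum_(k < N) s%:C%C ^+ k *: c k.
  rewrite -sum_rowterm; apply: eq_bigr => k _; rewrite /c rowtermZ // scalerA.
  by rewrite -exprMn -rmorphM divff ?gt_eqF // expr1n scale1r.
have c0 : c 0%N = 0.
  by apply: big1 => j _; rewrite /hterm sum_tuple0 a0 scale0r.
(* The Schwarz bound s (1 + e) is at most s + e because s <= 1. *)
apply: (@le_trans _ _ (s * (1 + e))).
  apply: (hpoly_schwarz ipP _ c0); last by rewrite (ltW s0).
  by move=> z z1; apply: KP => //; exact: leq_maxl.
by rewrite mulrDr mulr1 lerD2l ler_piMl // ltW.
Qed.

End Schwarz.

(** * Tuples of scalar operators and the matrix norm *)

Section ScalarTuples.
Variables (R : realType) (V : lmodType R[i]) (ip : V -> V -> R[i]).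
Hypothesis ipP : is_inner_product ip.
Local Notation nm := (hnorm ip).

Lemma bounded_op_scalar (c : R[i]) : bounded_op ip (fun v => c *: v).
Proof.
apply: (bounded_opZ ipP c (T := fun v => v)); split=> //.
by exists 1 => v; rewrite mul1r.
Qed.

(** Sum the inequalities |x_i| ||h_i|| <= (|x_i|^2 + ||h_i||^2) / 2. *)
Lemma scalar_row_bounded (n : nat) (x : 'I_n -> R[i]) :
  \sum_(i < n) cabs (x i) ^+ 2 <= 1 -> row_bounded ip 1 (fun i v => x i *: v).
Proof.
move=> x1 h h1; apply: le_trans (hnorm_sum ipP _) _.
apply: (@le_trans _ _ (\sum_(i < n) (cabs (x i) ^+ 2 + nm (h i) ^+ 2) / 2)).
  apply: ler_sum => i _; rewrite hnormZ // ler_pdivlMr //.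
  have := sqr_ge0 (cabs (x i) - nm (h i)); rewrite sqrrB -subr_ge0 subr0.
  by rewrite addrAC subr_ge0 mulr_natr.
by rewrite -mulr_suml big_split ler_pdivrMr // mul1r -[2]/(1 + 1) lerD.
Qed.

(** At the zero tuple only the empty word survives. This turns F(0) = 0 into the vanishing of the
    constant coefficients. *)
Lemma fh_value0 (n : nat) (a : seq 'I_n -> R[i]) :
  fh_value ip a (fun _ _ => 0) (fun h => a [::] *: h).
Proof.
split; first exact: bounded_op_scalar.
move=> e e0; exists 1%N => -[//|N] _; apply: le_lt_trans e0.
apply: (opnorm_le ipP) => h _; rewrite fh_partialE big_ord_recl.
rewrite {1}/hterm sum_tuple0 big1 => [|k _]; first by rewrite addr0 subrr hnorm0.
by apply: big1 => w _; case/tupleP: w => i w; rewrite scaler0.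
Qed.

(** For y = A x of norm t > 0 and a unit vector u, the row of vectors t^-1 conj(y_j) u has square
    sum 1 and is sent to t u; hence t <= s. *)
Lemma mxnorm_le (n m : nat) (A : 'M[R[i]]_(m, n)) (s : R) :
  (exists v : V, v != 0) ->
  (forall x : 'I_n -> R[i], \sum_(i < n) cabs (x i) ^+ 2 <= 1 ->
     row_bounded ip s (fun j h => \sum_(i < n) A j i *: (x i *: h))) ->
  mxnorm A <= s.
Proof.
move=> [v v0] As; apply: ge_sup => [|_ [x [x1 ->]]].
  exists (Num.sqrt (\sum_(j < m) cabs (\sum_(i < n) A j i * 0) ^+ 2)), (fun=> 0).
  by split=> //; rewrite big1 // => i _; rewrite /cabs normr0 expr0n.
set y := fun j => \sum_(i < n) A j i * x i; set S := \sum_(j < m) _.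
have s0 : 0 <= s := row_bounded_ge0 ipP (As x x1).
have S0 : 0 <= S by apply: sumr_ge0 => j _; exact: sqr_ge0.
have [->|Sn0] := eqVneq S 0; first by rewrite sqrtr0.
pose t := Num.sqrt S; have t0 : 0 < t by rewrite sqrtr_gt0 lt_def Sn0.
have v1 : 0 < nm v.
  rewrite lt_def hnorm_ge0 andbT; apply: contraNneq v0 => /(hnorm_eq0 ipP) ->.
  exact: eqxx.
pose u := ((nm v)^-1)%:C%C *: v.
have u1 : nm u = 1.
  by rewrite hnormZ // cabs_real ?invr_ge0 ?(ltW v1) // mulVf // gt_eqF.
pose b j := (t^-1)%:C%C * conjc (y j).
have bE j : cabs (b j) = t^-1 * cabs (y j).
  by rewrite cabsM cabs_real ?invr_ge0 ?(ltW t0) // /cabs normcJ.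
have := As x x1 (fun j => b j *: u).
have -> : \sum_(j < m) nm (b j *: u) ^+ 2 = 1.
  under eq_bigr do rewrite hnormZ // u1 mulr1 bE exprMn.
  by rewrite -mulr_sumr -/S -[S]sqr_sqrtr // -exprMn mulVf ?expr1n // gt_eqF.
have -> : \sum_(j < m) \sum_(i < n) A j i *: (x i *: (b j *: u)) = t%:C%C *: u.
  under eq_bigr => j _.
    under eq_bigr => i _ do rewrite scalerA.
    rewrite -scaler_suml scalerA -/(y j) /b mulrCA -sqr_normc normr_cabs.
    rewrite -rmorphXn -rmorphM; over.
  rewrite -scaler_suml -rmorph_sum /= -mulr_sumr -/S -[S]sqr_sqrtr // -/t.
  by rewrite expr2 mulKf // gt_eqF.
by rewrite hnormZ // u1 mulr1 cabs_real ?(ltW t0) //; apply.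
Qed.

End ScalarTuples.

Theorem mainTheorem16 (R : realType) (V : lmodType R[i]) (ip : V -> V -> R[i])
  (n m : nat) (a : 'I_m -> seq 'I_n -> R[i]) :
  is_inner_product ip -> hilbert_complete ip -> (exists v : V, v != 0) ->
  (* F = (F_1, ..., F_m) free holomorphic on [B(H)^n]_1, F_j with coefficients a j *)
  (forall j, free_holo_coeffs (a j)) ->
  (* F maps [B(H)^n]_1 into [B(H)^m]_1 *)
  (forall X : 'I_n -> V -> V, (forall i, bounded_op ip (X i)) -> rownorm ip X < 1 ->
     forall T : 'I_m -> V -> V, (forall j, fh_value ip (a j) X (T j)) ->
       rownorm ip T < 1) ->
  [/\ (* (i) phi(X) = [X_1,...,X_n] F'(0)^t maps [B(H)^n]_1 into [B(H)^m]_1 *)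
      (forall X : 'I_n -> V -> V, (forall i, bounded_op ip (X i)) -> rownorm ip X < 1 ->
         rownorm ip (fun j h => \sum_(i < n) a j [:: i] *: X i h) < 1),
      (* in particular ||F'(0)|| <= 1, where F'(0) = [a^{(j)}_{g_i}]_{j,i} *)
      mxnorm (\matrix_(j < m, i < n) a j [:: i]) <= 1 &
      (* (ii) if F(0) = 0 then ||F(X)|| <= ||X|| on [B(H)^n]_1 *)
      ((forall T0 : 'I_m -> V -> V,
          (forall j, fh_value ip (a j) (fun _ _ => 0) (T0 j)) ->
          forall j h, T0 j h = 0) ->
       forall X : 'I_n -> V -> V, (forall i, bounded_op ip (X i)) -> rownorm ip X < 1 ->
       forall T : 'I_m -> V -> V, (forall j, fh_value ip (a j) X (T j)) ->
         rownorm ip T <= rownorm ip X)].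
Proof.
move=> ipP complV Vn0 aP aF.
have rn0 X : (forall i, bounded_op ip (X i)) -> 0 <= rownorm ip (X : 'I_n -> _).
  by move=> Xb; exact: row_bounded_ge0 (row_bounded_rownorm ipP Xb).
split.
(* The midpoint s between the row norm and 1 makes the conclusion strict. *)
- move=> X Xb X1; have [rs s1] := midf_lt X1; set s := _ / 2 in rs s1.
  have s0 : 0 < s by exact: le_lt_trans (rn0 X Xb) rs.
  apply: le_lt_trans s1; apply: (rownorm_le ipP).
  exact: derivative_row_bounded.
(* The scalar tuple is only known to have row norm at most 1, so the radius 1 + e provides the
   strict inequality. *)
- apply/ler_addgt0Pr => e e0; apply: (mxnorm_le ipP) => // x x1.
  have Xb i : bounded_op ip (fun v => x i *: v) by exact: bounded_op_scalar.
  have s0 : 0 < 1 + e by rewrite addr_gt0.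
  have rs : rownorm ip (fun i v => x i *: v) < 1 + e.
    by apply: le_lt_trans (rownorm_le ipP (scalar_row_bounded ipP x1)) _; rewrite ltrDl.
  move=> h h1; under eq_bigr do under eq_bigr do rewrite mxE.
  exact: (derivative_row_bounded ipP complV aP aF Xb s0 rs).
- move=> F0 X Xb X1 T TX; have a0 j : a j [::] = 0.
    have [v v0] := Vn0; have := F0 _ (fun j => fh_value0 ipP (a j)) j v.
    by move/eqP; rewrite scaler_eq0 (negPf v0) orbF => /eqP.
  apply/ler_addgt0Pr => e e0; apply: (rownorm_le ipP).
  (* The Schwarz estimate needs a radius at most 1: [rownorm ip X + e] if possible, otherwise 1,
     which is then at most that sum. *)
  have [le1|/ltW le1] := leP (rownorm ip X + e) 1.
    apply: (schwarz_row_bounded ipP complV aP aF a0 Xb _ _ TX); last by rewrite ltrDl.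
    by rewrite le1 andbT ltr_wpDl // rn0.
  move=> h h1; apply: le_trans le1.
  by apply: (schwarz_row_bounded ipP complV aP aF a0 Xb _ X1 TX) h1; rewrite ltr01 lexx.
Qed.
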